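(* Fix a real number $\rho>0$ and integers $M\ge0$, $N\ge1$. Given a matrix $A\in\mathcal{P}_N(\overline{D}(0,\rho))$, let $$A_0:=c_0\mathbf{1}_{N\times N}+c_1A+\cdots+c_{N-1}A^{\circ(N-1)}\qquad\text{and}\qquad A_m:=A^{\circ(N-1+m)}\quad\text{for }1\le m\le M+1,$$ where the coefficients $c_0,\dots,c_{N-1}>0$, and for $\eta>0$ let $$\mathcal{U}[\eta]:=\Bigl\{A_0+\sum_{m=1}^{M+1}u_mA_m:\ u_m\in[-\eta,\eta]\Bigr\}.$$ Then $$\eta\le\Bigl(\sum_{m=0}^M\mathcal{C}(\mathbf{c};z^{N+m};N,\rho)\Bigr)^{-1}\ \Longrightarrow\ \mathcal{U}[\eta]\subset\mathcal{P}_N(\mathbb{C})\ \Longrightarrow\ \eta\le\mathcal{C}(\mathbf{c};z^{N+M};N,\rho)^{-1}.$$ The upper and lower bounds for $\eta$ are asymptotically equal as $N\to\infty$, i.e., $$\lim_{N\to\infty}\mathcal{C}(\mathbf{c};z^{N+M};N,\rho)^{-1}\sum_{m=0}^M\mathcal{C}(\mathbf{c};z^{N+m};N,\rho)=1.$$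
   Context: $\overline{D}(0,\rho)$ is the closed disc in $\mathbb{C}$ with center $0$ and radius $\rho$. $\mathcal{P}_N(K)$ is the set of positive semidefinite $N\times N$ matrices with entries in $K\subset\mathbb{C}$. For $A=(a_{ij})$, $A^{\circ k}:=(a_{ij}^k)$ is the $k$th Hadamard (entrywise) power; $\mathbf{1}_{N\times N}$ is the $N\times N$ matrix with all entries $1$. The sets $\mathcal{U}[\eta]$ are the matrix cubes corresponding to $A_0,\dots,A_{M+1}$. For an integer $L\ge N$ and $\mathbf{c}=(c_0,\dots,c_{N-1})\in(0,\infty)^N$, $$\mathcal{C}(\mathbf{c};z^L;N,\rho):=\sum_{j=0}^{N-1}\binom{L}{j}^2\binom{L-j-1}{N-j-1}^2\frac{\rho^{L-j}}{c_j}.$$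
   Formalization: In the second implication, the condition U[η] ⊂ P_N(C) is assumed for all A in P_N(D̄(0,ρ)), not for one fixed A: for A = 0 the cube is {c_0·1}, positive semidefinite for every η, so the fixed-A version is false. *)

(* Defs.v *)
From HB Require Import structures.
From mathcomp Require Import all_boot all_order all_algebra.
From mathcomp Require Import sesquilinear spectral complex.
From mathcomp Require Import all_classical all_reals all_analysis.

Set Implicit Arguments.
Unset Strict Implicit.
Unset Printing Implicit Defensive.
Import Order.TTheory GRing.Theory Num.Theory.

Local Open Scope classical_set_scope.
Local Open Scope sesquilinear_scope.
Local Open Scope complex_scope.
Local Open Scope ring_scope.

(* The norm of R[i] takes its values in R[i], so the radius is embedded. *)
Definition closed_disc (R : realType) (rho : R) : set R[i] :=
  [set z | `|z| <= rho%:C].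

(* In R[i], [0 <= z] means that z is real and nonnegative. *)
Definition psdmx (R : realType) (N : nat) (A : 'M[R[i]]_N) : Prop :=
  A \is hermsymmx /\ forall v : 'cV[R[i]]_N, 0 <= (v ^t* *m A *m v) 0 0.

Definition psd_over (R : realType) (N : nat) (K : set R[i]) :
    set 'M[R[i]]_N :=
  [set A | psdmx A /\ forall i j, K (A i j)].

(* For k = 0 this is the all-ones matrix, since [0 ^+ 0 = 1]. *)
Definition hadamard_exp (R : realType) (N : nat) (A : 'M[R[i]]_N) (k : nat) :
    'M[R[i]]_N :=
  map_mx (fun z => z ^+ k) A.

Lemma hadamard_exp0 (R : realType) (N : nat) (A : 'M[R[i]]_N) :
  hadamard_exp A 0 = const_mx 1.
Proof. by apply/matrixP => i j; rewrite !mxE expr0. Qed.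

(* The matrices A_0, A_1, A_2, ... attached to A and c_0, ..., c_(N-1). *)
Definition cube_term (R : realType) (N : nat) (c : 'I_N -> R)
    (A : 'M[R[i]]_N) (m : nat) : 'M[R[i]]_N :=
  if m is 0%N then \sum_(j < N) (c j)%:C *: hadamard_exp A j
  else hadamard_exp A (N - 1 + m).

(* The matrix cube of B_0, ..., B_n; only u_1, ..., u_n are used. *)
Definition matrix_cube (R : realType) (N n : nat) (B : nat -> 'M[R[i]]_N)
    (eta : R) : set 'M[R[i]]_N :=
  [set X | exists2 u : nat -> R,
     forall m, (1 <= m <= n)%N -> - eta <= u m <= eta &
     X = B 0%N + \sum_(1 <= m < n.+1) (u m)%:C *: B m].

(* C(c; z^L; N, rho), meaningful for [N <= L], when no nat subtraction below
   is truncated. *)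
Definition Ccst (R : realType) (N : nat) (c : 'I_N -> R) (L : nat) (rho : R) :
    R :=
  \sum_(j < N) ('C(L, j) ^ 2 * 'C(L - j - 1, N - j - 1) ^ 2)%:R
               * (rho ^+ (L - j) / c j).

(* Main.v *)
Require Import Defs.
From HB Require Import structures.
From mathcomp Require Import all_boot all_order all_algebra.
From mathcomp Require Import sesquilinear spectral complex.
From mathcomp Require Import all_classical all_reals all_analysis.
From mathcomp Require Import ring lra zify.

Set Implicit Arguments.
Unset Strict Implicit.
Unset Printing Implicit Defensive.
Import Order.TTheory GRing.Theory Num.Theory.
Import numFieldNormedType.Exports.

Local Open Scope classical_set_scope.
Local Open Scope ring_scope.

(** The heart of the matter is a single Loewner inequality.  If [A] is positive
    semidefinite of size [N] with diagonal at most [rho] and [L = a + N], then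
<<
      A^(o L)  <=  C(c; z^L; N, rho) * sum_(j < N) c_j A^(o j).
>>
    - Interpolation.  Each [x] among the nodes [x_1, ..., x_N] satisfies
      [x ^ L = sum_j (+-) H_j x ^ j], where [H_j] is, up to sign, a coefficient
      of the remainder of [X ^ L] modulo [prod_i (X - x_i)].  It is the Schur
      polynomial of a hook; the recursion chosen here ([hook_poly]) shows that
      [H_j] is a sum of ['C(L, j) * 'C(L - j - 1, N - j - 1)] monomials of
      degree [L - j], all with coefficient one ([exp_node_hook_poly],
      [hook_poly_bound]).  The weights of [C] are the squares of these numbers.

    - From scalars to matrices.  Take for nodes the entries of the [i]-th
      column of [A] and apply the identity to [x = A k i].  Then
      [v^* A^(o L) v] is the sum over [j] of [(+-) v^* A^(o j) (D_j v)], where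
      the diagonal matrix [D_j] has the hook polynomials of the columns for
      entries.  If [A] is the Gram matrix of vectors [a_t], multiplying by the
      diagonal matrix of the row [t] of [A] amounts to contracting a tensor
      factor with [a_t]; this gives [D^* B D <= rho (B o A)] for every positive
      [B] ([gram_row_bound]).  Such bounds are multiplicative, and additive by
      Minkowski's inequality ([mul_bound_graded]), so that
      [D_j^* A^(o j) D_j <= K_j^2 rho^(L - j) A^(o L)] with [K_j] the number of
      monomials.  The arithmetic-geometric mean inequality, with weights [c_j],
      concludes ([hadamard_domination]).

    Summing these inequalities over [L = N, ..., N + M] gives the first
    implication.  For the second, the matrix [A = x x^T] with distinct
    positive nodes turns positivity into an inequality between moments; a
    vector with prescribed moments (Vandermonde) makes it read
    [eta * sum_j H_j(x)^2 / c_j <= 1].  The monomials of [H_j] do not cancel, so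
    letting all nodes tend to [sqrt rho] yields [eta * C <= 1].  Finally, the
    numbers of monomials for [L] and [L + 1] differ by a factor of order [N],
    whence [C(c; z^(N+m); N, rho) = O(N^-2) C(c; z^(N+m+1); N, rho)] uniformly
    in [c], and the last term dominates the sum. *)

(** * Hook polynomials and interpolation *)

Section Hook.
Variable R : comNzRingType.
Implicit Types (s : seq R) (x y : R) (a : nat).

(** The complete homogeneous symmetric polynomial of degree [a] in the entries
    of [s]. *)
Fixpoint hsym s a : R :=
  if s is y :: s' then
    (fix hs a := if a is b.+1 then y * hs b + hsym s' a else 1) a
  else (a == 0)%:R.

Lemma hsym0 s : hsym s 0 = 1.
Proof. by case: s => //=; rewrite eqxx. Qed.

Lemma hsymS y s a : hsym (y :: s) a.+1 = y * hsym (y :: s) a + hsym s a.+1.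
Proof. by []. Qed.

(** The divided difference of [x |-> hsym (x :: s) a.+1] at [x, y]. *)
Lemma hsym_diff x y s a :
  (x - y) * hsym [:: x, y & s] a = hsym (x :: s) a.+1 - hsym (y :: s) a.+1.
Proof.
elim: a => [|a IH]; first by rewrite !hsymS !hsym0; ring.
rewrite hsymS mulrDr mulrCA IH (hsymS x s a.+1) (hsymS y s a.+1).
ring.
Qed.

Definition prod_XaddC s : {poly R} := \prod_(x <- s) ('X + x%:P).

(** The usual Newton form of the remainder of ['X ^+ (a + size s)] modulo the
    product of the [('X - y)] has cancellations between its terms.  Here the
    nodes are kept in a product on the high-order side, and the variable is
    replaced by its opposite: the result has coefficients that are sums of
    monomials in the nodes, without signs.  They are the Schur polynomials of
    the hooks with arm length [a]. *)
Fixpoint hook_poly a s : {poly R} :=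
  if s is y :: s' then
    (y * hsym (y :: s') a) *: prod_XaddC s' + 'X * hook_poly a s'
  else 0.

(** By induction on the nodes: the step from [s] to [y :: s] is the relation
    [x h_a(x, s) = y h_a(y, s) + (x - y) h_a(x, y, s)], which is [hsym_diff]
    expanded by [hsymS]. *)
Lemma hook_poly_interp x s a :
  x ^+ (a + size s) =
    - (-1) ^+ size s * (hook_poly a s).[- x]
    + hsym (x :: s) a * \prod_(y <- s) (x - y).
Proof.
elim: s => [|y s IH].
  rewrite big_nil horner0 mulr0 add0r mulr1 addn0.
  by elim: a => [|a IHa] //; rewrite hsymS -IHa addr0 exprS.
(* all factors change sign at [- x] *)
have evalE : (prod_XaddC s).[- x] = (-1) ^+ size s * \prod_(z <- s) (x - z).
  rewrite /prod_XaddC horner_prod; elim: s {IH} => [|z s IHs].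
    by rewrite !big_nil mulr1.
  rewrite !big_cons IHs hornerD hornerX hornerC.
  by rewrite -[size (z :: s)]/(size s).+1 exprS; ring.
have sgn2 : (-1 : R) ^+ size s * (-1) ^+ size s = 1.
  by rewrite -exprMn mulrNN mulr1 expr1n.
rewrite addnS exprS IH big_cons hornerD hornerZ evalE.
rewrite -[size (y :: s)]/(size s).+1.
rewrite hornerM hornerX.
rewrite [(-1) ^+ (size s).+1]exprS.
set e := (-1) ^+ size s in sgn2 *; set P := \prod_(z <- s) _.
set h := (hook_poly a s).[_].
have := hsym_diff x y s a; rewrite !hsymS.
set g := hsym [:: x, y & s] a; set hx := hsym (x :: s) a.
set hy := hsym (y :: s) a => hd.
transitivity (x * (- e * h + hx * P) + (e * e - 1) * (y * hy * P)
  + ((x - y) * g - (x * hx + hsym s a.+1 - (y * hy + hsym s a.+1))) * P);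
  last by rewrite -mulrA; ring.
by rewrite sgn2 hd !subrr !mul0r !addr0.
Qed.

Lemma size_prod_XaddC s : size (prod_XaddC s) = (size s).+1.
Proof.
rewrite /prod_XaddC -(size_prod_XsubC s (fun x => - x)).
by congr (size (polyseq _)); apply: eq_bigr => x _; rewrite polyCN opprK.
Qed.

Lemma size_hook_poly a s : (size (hook_poly a s) <= size s)%N.
Proof.
elim: s => [|y s IH] /=; first by rewrite size_poly0.
rewrite (leq_trans (size_polyD _ _)) // geq_max.
rewrite (leq_trans (size_scale_leq _ _)) ?size_prod_XaddC //=.
have [->|h0] := eqVneq (hook_poly a s) 0; first by rewrite mulr0 size_poly0.
by rewrite mulrC size_mulX.
Qed.

Lemma exp_node_hook_poly x s a : x \in s ->
  x ^+ (a + size s) = \sum_(j < size s)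
    (- (-1) ^+ size s * (-1) ^+ j) * ((hook_poly a s)`_j * x ^+ j).
Proof.
move=> xs; rewrite (hook_poly_interp x s a).
rewrite (_ : \prod_(y <- s) (x - y) = 0) ?mulr0 ?addr0.
  rewrite (horner_coef_wide _ (size_hook_poly a s)) mulr_sumr; apply: eq_bigr => j _.
  by rewrite [(- x) ^+ _]exprNn; ring.
by rewrite (big_rem x) //= subrr mul0r.
Qed.

End Hook.

(** The number of monomials of the coefficient of degree [j] of [hook_poly a s]
    when [s] has [n] nodes, in the form it takes in the constant [Ccst]. *)
Definition hook_count (a n j : nat) : nat :=
  if (j < n)%N then ('C(a + n, j) * 'C(a + n - j - 1, n - j - 1))%N else 0%N.

Lemma hook_countS0 a n : hook_count a n.+1 0 = 'C(a + n, a).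
Proof.
rewrite /hook_count ltn0Sn bin0 mul1n !subn0 !subn1 addnS /=.
by rewrite -[in LHS]bin_sub ?leq_addl // addnK.
Qed.

(** The recursion of [hook_poly] read on numbers of monomials.  After Pascal's
    rule for ['C(a + n.+1, j.+1)] it is the equality of two expressions of a
    multinomial coefficient. *)
Lemma hook_countS a n j :
  hook_count a n.+1 j.+1 = ('C(a + n, a) * 'C(n, j.+1) + hook_count a n j)%N.
Proof.
rewrite /hook_count ltnS; case: ltnP => [jn|nj]; last first.
  by rewrite (@bin_small n) ?muln0 ?ltnS.
rewrite addnS binS mulnDl !subSS.
congr (_ + _).
have -> : (a + n - j - 1 = a + n - j.+1)%N by lia.
have -> : (n - j - 1 = n - j.+1)%N by lia.
have f1 k := fact_gt0 k.
have b1 : ('C(a + n, j.+1) * (j.+1 `! * (a + n - j.+1)`!) = (a + n)`!)%N.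
  by apply: bin_fact; lia.
have b2 : ('C(a + n - j.+1, n - j.+1) * ((n - j.+1)`! * a`!)
           = (a + n - j.+1)`!)%N.
  by rewrite -[in RHS](@bin_fact _ (n - j.+1)); [congr (_ * (_ * _`!)); lia|lia].
have b3 : ('C(a + n, a) * (a`! * n`!) = (a + n)`!)%N.
  by rewrite -[in RHS](@bin_fact _ a); [congr (_ * (_ * _`!)); lia|lia].
have b4 : ('C(n, j.+1) * (j.+1`! * (n - j.+1)`!) = n`!)%N by exact: bin_fact.
have p : (0 < a`! * j.+1`! * (n - j.+1)`!)%N by rewrite !muln_gt0 !f1.
apply/eqP; rewrite -(eqn_pmul2r p); apply/eqP.
transitivity (a + n)`!.
  by rewrite -b1 -b2; ring.
by rewrite -b3 -b4; ring.
Qed.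

(** [D d k f] is to be read as: [f] behaves like a sum of [k] monomials of degree
    [d].  Functions rather than elements of [R] are needed because the bounds
    for matrices concern all the columns at once; the same axioms serve for
    norms (upper bounds) and for values at positive nodes (lower bounds). *)
Record graded_bound (I : Type) (R : comNzRingType)
    (D : nat -> nat -> (I -> R) -> Prop) : Prop := GradedBound {
  gb_ext : forall d k f g, D d k f -> f =1 g -> D d k g;
  gb0 : forall d, D d 0 (fun=> 0);
  gb1 : D 0 1 (fun=> 1);
  gbD : forall d k l f g, D d k f -> D d l g -> D d (k + l)%N (fun i => f i + g i);
  gbM : forall d e k l f g,
    D d k f -> D e l g -> D (d + e)%N (k * l)%N (fun i => f i * g i)
}.

Section GradedBound.
Variables (T I : Type) (R : comNzRingType) (D : nat -> nat -> (I -> R) -> Prop).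
Hypothesis gD : graded_bound D.
Variable y : T -> I -> R.
Hypothesis Dy : forall t, D 1 1 (y t).

Let col (s : seq T) i := [seq y t i | t <- s].

(** A homogeneous polynomial of degree [a] in [n] variables has
    ['C(a + n - 1, a)] monomials; the truncated difference also gives the right
    value for [n = 0]. *)
Lemma hsym_bound s a :
  D a 'C(a + size s - 1, a) (fun i => hsym (col s i) a).
Proof.
elim: s a => [|t s IHs].
  case=> [|a]; first by rewrite bin0; apply: (gb_ext gD (gb1 gD)) => i.
  by rewrite addn0 subn1 bin_small //; apply: (gb_ext gD (gb0 gD _)) => i.
elim=> [|a IHa].
  by rewrite bin0; apply: (gb_ext gD (gb1 gD)) => i; rewrite hsym0.
have -> : 'C(a.+1 + size (t :: s) - 1, a.+1)
  = (1 * 'C(a + size (t :: s) - 1, a) + 'C(a.+1 + size s - 1, a.+1))%N.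
  by rewrite /= !addnS !addSn !subn1 /= binS mul1n addnC.
by apply: (gb_ext gD (gbD gD (gbM gD (Dy t) IHa) (IHs a.+1))) => i.
Qed.

Lemma prod_XaddC_bound s j d : (d + j = size s)%N ->
  D d 'C(size s, j) (fun i => (prod_XaddC (col s i))`_j).
Proof.
have coefS t s' k i : (prod_XaddC (col (t :: s') i))`_k.+1
    = (prod_XaddC (col s' i))`_k + y t i * (prod_XaddC (col s' i))`_k.+1.
  by rewrite /prod_XaddC /= big_cons mulrDl coefD coefXM coefCM.
have coef0 t s' i : (prod_XaddC (col (t :: s') i))`_0
    = y t i * (prod_XaddC (col s' i))`_0.
  by rewrite /prod_XaddC /= big_cons mulrDl coefD coefXM coefCM add0r.
elim: s j d => [|t s IHs] j d /=.
  move=> /eqP; rewrite addn_eq0 => /andP[/eqP -> /eqP ->].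
  by apply: (gb_ext gD (gb1 gD)) => i; rewrite /prod_XaddC big_nil coef1.
case: j => [|j].
  rewrite addn0 => ->; rewrite -add1n (_ : 'C(_, 0) = 1 * 'C(size s, 0))%N ?bin0 //.
  have b0 := IHs 0%N _ (addn0 _); rewrite bin0 in b0.
  apply: (gb_ext gD (gbM gD (Dy t) b0)) => i.
  by rewrite coef0.
rewrite addnS => -[djs]; rewrite binS addnC.
apply: (gb_ext gD (gbD gD (IHs j d djs)
  (_ : D d _ (fun i => y t i * (prod_XaddC (col s i))`_j.+1)))); last first.
  by move=> i; rewrite coefS.
case: d djs => [djs|d djs].
  rewrite bin_small -?djs ?add0n //.
  apply: (gb_ext gD (gb0 gD _)) => i.
  by rewrite nth_default ?mulr0 // size_prod_XaddC size_map -djs.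
rewrite -[d.+1]add1n -[X in D _ X]mul1n.
by apply: (gbM gD (Dy t) (IHs _ _ _)); rewrite -djs addnS.
Qed.

Lemma hook_poly_bound a s j d : (d + j = a + size s)%N ->
  D d (hook_count a (size s) j) (fun i => (hook_poly a (col s i))`_j).
Proof.
have coefE t s' k i : (hook_poly a (col (t :: s') i))`_k
    = (y t i * hsym (col (t :: s') i) a) * (prod_XaddC (col s' i))`_k
      + (if k is l.+1 then (hook_poly a (col s' i))`_l else 0).
  by rewrite [hook_poly _ _]/= coefD coefZ coefXM; case: k.
(* the summand of [hook_poly a (t :: s')] that is new at this stage *)
have lead_bound t s' k e : (e + k = a + (size s').+1)%N ->
    D e ('C(a + size s', a) * 'C(size s', k))%N
      (fun i => (y t i * hsym (col (t :: s') i) a) * (prod_XaddC (col s' i))`_k).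
  move=> eks; have [ks|sk] := leqP k (size s'); last first.
    rewrite (@bin_small (size s')) // muln0; apply: (gb_ext gD (gb0 gD _)) => i.
    by rewrite nth_default ?mulr0 // size_prod_XaddC size_map.
  have -> : e = (1 + a + (size s' - k))%N by lia.
  have := hsym_bound (t :: s') a; rewrite /= addnS subn1 /= => hb.
  rewrite -[X in (X * _)%N]mul1n.
  by apply: (gbM gD (gbM gD (Dy t) hb) (prod_XaddC_bound _)); rewrite subnK.
elim: s j d => [|t s IHs] j d djs.
  by apply: (gb_ext gD (gb0 gD _)) => i; rewrite /= coef0.
case: j djs => [|j] djs.
  rewrite hook_countS0 -[X in D _ X]muln1.
  have := lead_bound t s 0%N d djs; rewrite bin0 => b0.
  by apply: (gb_ext gD b0) => i; rewrite coefE addr0.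
rewrite hook_countS.
apply: (gb_ext gD (gbD gD (lead_bound t s _ d djs) (IHs j d _))); last first.
  by move=> i; rewrite coefE.
by move: djs; rewrite /= !addnS => -[].
Qed.

End GradedBound.

(** * Gram kernels and multiplication bounds *)

Section Ineq.
Variables (C : numClosedFieldType) (K : finType).
Implicit Types x y : K -> C.

Lemma cauchy_schwarz_sum x y :
  `|\sum_k x k * y k| ^+ 2 <= (\sum_k `|x k| ^+ 2) * (\sum_k `|y k| ^+ 2).
Proof.
pose u := \row_i x (enum_val i : K) : 'rV_#|K|.
pose v := \row_i (y (enum_val i : K))^* : 'rV_#|K|.
have [+ _] := CauchySchwarz (@dotmx C #|K|) u v.
rewrite /= !dotmxE.
have sumE (F : K -> C) : \sum_k F k = \sum_(i < #|K|) F (enum_val i).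
  by rewrite (reindex _ (onW_bij _ (@enum_val_bij K))).
rewrite !mxE !sumE; congr (_ <= _ * _); last 2 first.
- by apply: eq_bigr => i _; rewrite !mxE normCK.
- by apply: eq_bigr => i _; rewrite !mxE conjCK normCK mulrC.
congr (`|_| ^+ 2); apply: eq_bigr => i _.
by rewrite !mxE conjCK.
Qed.

Lemma sqr_normD_le (a b p q : C) : 0 <= a -> 0 <= b ->
  a * b * `|p + q| ^+ 2 <= (a + b) * (b * `|p| ^+ 2 + a * `|q| ^+ 2).
Proof.
move=> a0 b0; have ab0 : 0 <= a * b by rewrite mulr_ge0.
have pq0 : 0 <= `|p| + `|q| by rewrite addr_ge0.
have := ler_wpM2l ab0 (lerXn2r 2 (normr_ge0 _) pq0 (ler_normD p q)).
move=> /le_trans; apply; rewrite -subr_ge0.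
rewrite [X in 0 <= X](_ : _ = (b * `|p| - a * `|q|) ^+ 2); last by ring.
by rewrite real_exprn_even_ge0 // rpredB // rpredM ?normr_real ?ger0_real.
Qed.

(** Minkowski's inequality for bounds in the form [k ^+ 2 * t]: it follows from
    the convexity inequality [sqr_normD_le] with weights [k] and [l], unless one
    of them is zero, in which case that summand vanishes. *)
Lemma minkowski_bound x y (k l : nat) (t : C) : 0 <= t ->
  \sum_i `|x i| ^+ 2 <= k%:R ^+ 2 * t ->
  \sum_i `|y i| ^+ 2 <= l%:R ^+ 2 * t ->
  \sum_i `|x i + y i| ^+ 2 <= (k + l)%:R ^+ 2 * t.
Proof.
have null (z : K -> C) : \sum_i `|z i| ^+ 2 <= (0%:R : C) ^+ 2 * t -> z =1 fun=> 0.
  rewrite expr0n mul0r => z0 i; apply/eqP.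
  have /eqP : \sum_i `|z i| ^+ 2 = 0.
    by apply/eqP; rewrite eq_le z0 sumr_ge0 // => j _; rewrite exprn_ge0.
  rewrite psumr_eq0 => [/allP /(_ i)|j _]; last by rewrite exprn_ge0.
  by rewrite mem_index_enum /= sqrf_eq0 => /(_ isT); rewrite normr_eq0.
move=> t0; case: k => [/null x0 hy|k].
  by rewrite add0n; under eq_bigr do rewrite x0 add0r.
case: l => [hx /null y0|l hx hy].
  by rewrite addn0; under eq_bigr do rewrite y0 addr0.
have kl0 : 0 < k.+1%:R * l.+1%:R :> C by rewrite mulr_gt0 ?ltr0Sn.
rewrite -(ler_pM2l kl0) mulr_sumr.
apply: (@le_trans _ _ ((k.+1%:R + l.+1%:R) *
    (l.+1%:R * (k.+1%:R ^+ 2 * t) + k.+1%:R * (l.+1%:R ^+ 2 * t)))); last first.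
  by rewrite le_eqVlt natrD; apply/orP; left; apply/eqP; ring.
apply: (@le_trans _ _ ((k.+1%:R + l.+1%:R) *
  (l.+1%:R * (\sum_i `|x i| ^+ 2) + k.+1%:R * (\sum_i `|y i| ^+ 2)))).
  rewrite 2!mulr_sumr -big_split mulr_sumr; apply: ler_sum => i _.
  by apply: sqr_normD_le; rewrite ler0n.
by rewrite ler_pM2l ?addr_gt0 ?ltr0Sn // lerD // ler_pM2l ?ltr0Sn.
Qed.

End Ineq.

Section Kernel.
Variables (C : numClosedFieldType) (I : finType).
Implicit Types (A B : I -> I -> C) (u w f g : I -> C).

Definition sform B u w : C := \sum_i \sum_j (u i)^* * B i j * w j.

(** Positive semidefiniteness in factored form: with it, Hadamard products and
    quadratic forms reduce to sums of squares. *)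
Definition gram_kernel B : Prop :=
  exists (K : finType) (Q : K -> I -> C),
    forall i j, B i j = \sum_k (Q k i)^* * Q k j.

Lemma eq_sform A B u w : (forall i j, A i j = B i j) -> sform A u w = sform B u w.
Proof. by move=> AB; do 2!apply: eq_bigr => ? _; rewrite AB. Qed.

Lemma sform_gram B (K : finType) (Q : K -> I -> C) u :
  (forall i j, B i j = \sum_k (Q k i)^* * Q k j) ->
  sform B u u = \sum_k `|\sum_i Q k i * u i| ^+ 2.
Proof.
move=> BQ; rewrite /sform.
transitivity (\sum_i \sum_j \sum_k (u i)^* * ((Q k i)^* * Q k j) * u j).
  by do 2!apply: eq_bigr => ? _; rewrite BQ mulr_sumr mulr_suml.
under eq_bigr do rewrite exchange_big; rewrite exchange_big.
apply: eq_bigr => k _; rewrite normCKC rmorph_sum mulr_suml.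
apply: eq_bigr => i _; rewrite mulr_sumr; apply: eq_bigr => j _.
by rewrite rmorphM; ring.
Qed.

Lemma gram_ge0 B u : gram_kernel B -> 0 <= sform B u u.
Proof.
by move=> [K [Q BQ]]; rewrite (sform_gram _ BQ) sumr_ge0 // => k _; rewrite exprn_ge0.
Qed.

Lemma gram_conj B i j : gram_kernel B -> (B i j)^* = B j i.
Proof.
move=> [K [Q BQ]]; rewrite !BQ rmorph_sum; apply: eq_bigr => k _.
by rewrite rmorphM /= conjCK mulrC.
Qed.

Lemma gram_const1 : gram_kernel (fun _ _ => 1).
Proof.
by exists unit, (fun _ _ => 1) => i j; rewrite sumr_const card_unit conjC1 mul1r.
Qed.

(** The Schur product theorem: the Hadamard product of Gram kernels is the Gram
    kernel of the tensor products. *)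
Lemma gram_mul A B : gram_kernel A -> gram_kernel B ->
  gram_kernel (fun i j => A i j * B i j).
Proof.
move=> [K [Q AQ]] [L [P BP]]; exists (K * L)%type, (fun kl i => Q kl.1 i * P kl.2 i).
move=> i j; rewrite AQ BP mulr_suml -(pair_bigA _ (fun k l =>
  (Q k i * P l i)^* * (Q k j * P l j))) /=; apply: eq_bigr => k _.
by rewrite mulr_sumr; apply: eq_bigr => l _; rewrite rmorphM; ring.
Qed.

Lemma gram_exp A k : gram_kernel A -> gram_kernel (fun i j => A i j ^+ k).
Proof.
move=> gA; elim: k => [|k /(gram_mul gA)]; first exact: gram_const1.
by case=> K [Q AQ]; exists K, Q => i j; rewrite exprS AQ.
Qed.

(** If [A] and [B] are the Gram kernels of vectors [a_i] and [b_i], then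
    multiplying [w] by row [t] of [A] amounts to contracting the tensor
    [\sum_i w i (b_i (x) a_i)] with [a_t], an operator of norm [|a_t|]. *)
Lemma gram_row_bound A B t w : gram_kernel A -> gram_kernel B ->
  sform B (fun i => A t i * w i) (fun i => A t i * w i)
    <= A t t * sform (fun i j => B i j * A i j) w w.
Proof.
move=> [K [Q AQ]] [L [P BP]].
have BAE i j : B i j * A i j = \sum_(lk : L * K)
    (P lk.1 i * Q lk.2 i)^* * (P lk.1 j * Q lk.2 j).
  rewrite AQ BP mulr_suml -(pair_bigA _ (fun l k =>
    (P l i * Q k i)^* * (P l j * Q k j))) /=; apply: eq_bigr => k _.
  by rewrite mulr_sumr; apply: eq_bigr => l _; rewrite rmorphM; ring.
rewrite (sform_gram _ BP) (sform_gram _ BAE).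
rewrite -(pair_bigA _ (fun l k => `|\sum_i P l i * Q k i * w i| ^+ 2)) /=.
rewrite mulr_sumr; apply: ler_sum => l _.
have -> : A t t = \sum_k `|(Q k t)^*| ^+ 2.
  by rewrite AQ; apply: eq_bigr => k _; rewrite norm_conjC normCKC.
rewrite [X in `|X|](_ : _ =
  \sum_k (Q k t)^* * \sum_i P l i * Q k i * w i); first exact: cauchy_schwarz_sum.
under [RHS]eq_bigr do rewrite mulr_sumr.
rewrite exchange_big; apply: eq_bigr => i _ /=.
rewrite AQ mulr_suml mulr_sumr; apply: eq_bigr => k _; ring.
Qed.

End Kernel.

Section Bound.
Variables (C : numClosedFieldType) (I : finType) (A : I -> I -> C) (rho : C).
Hypothesis gA : gram_kernel A.
Hypothesis A_le : forall t, A t t <= rho.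

(** Multiplication by [f] maps the seminorm of [B o A^(o d)] to the seminorm of
    [B] with norm at most [k * rho ^ (d / 2)], for all positive [B] at once.
    The quantification over [B] makes these bounds multiplicative. *)
Definition mul_bound (d k : nat) (f : I -> C) : Prop :=
  forall B, gram_kernel B -> forall w,
    sform B (fun i => f i * w i) (fun i => f i * w i)
      <= k%:R ^+ 2 * (rho ^+ d * sform (fun i j => B i j * A i j ^+ d) w w).

Lemma mul_bound_row t : mul_bound 1 1 (A t).
Proof.
move=> B gB w; rewrite expr1n mul1r expr1.
apply: le_trans (gram_row_bound t w gA gB) _.
apply: ler_wpM2r (A_le t).
exact: (gram_ge0 w (gram_mul gB gA)).
Qed.

Hypothesis rho_ge0 : 0 <= rho.

(** Sums are handled by Minkowski's inequality in the Gram factorization of [B],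
    products by applying the second bound to [B o A^(o d)], which is again a Gram
    kernel. *)
Lemma mul_bound_graded : graded_bound mul_bound.
Proof.
have gBA d B : gram_kernel B -> gram_kernel (fun i j => B i j * A i j ^+ d).
  by move=> gB; apply: gram_mul gB (gram_exp d gA).
split.
- move=> d k f g hf fg B gB w; apply: le_trans (hf B gB w).
  by rewrite /sform le_eqVlt; apply/orP; left; apply/eqP;
    do 2!apply: eq_bigr => ? _; rewrite !fg.
- move=> d B gB w; rewrite expr0n mul0r /sform big1 // => i _.
  by rewrite big1 // => j _; rewrite !mul0r mulr0.
- move=> B gB w; rewrite expr1n !mul1r /sform le_eqVlt.
  by apply/orP; left; apply/eqP; do 2!apply: eq_bigr => ? _;
    rewrite expr0 mulr1 !mul1r.
- move=> d k l f g hf hg B gB w.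
  have t0 : 0 <= rho ^+ d * sform (fun i j => B i j * A i j ^+ d) w w.
    by rewrite mulr_ge0 ?exprn_ge0 ?(gram_ge0 _ (gBA _ _ gB)).
  have := hf B gB w; have := hg B gB w.
  case: (gB) => K [Q BQ]; rewrite !(sform_gram _ BQ) => bg bf.
  rewrite [X in X <= _](_ : _ = \sum_k
    `|(\sum_i Q k i * (f i * w i)) + (\sum_i Q k i * (g i * w i))| ^+ 2).
    exact: minkowski_bound bf bg.
  apply: eq_bigr => m _; rewrite -big_split /=; congr (`|_| ^+ 2).
  by apply: eq_bigr => i _; ring.
- move=> d e k l f g hf hg B gB w.
  have := hg _ (gBA d _ gB) w => bg.
  have := hf B gB (fun i => g i * w i) => bf.
  rewrite [X in X <= _](_ : _ = sform B (fun i => f i * (g i * w i))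
      (fun i => f i * (g i * w i))); last first.
    by do 2!apply: eq_bigr => ? _; rewrite !mulrA.
  apply: le_trans bf _.
  apply: le_trans (ler_wpM2l _ (ler_wpM2l _ bg)) _; rewrite ?exprn_ge0 ?ler0n //.
  rewrite natrM exprD le_eqVlt; apply/orP; left; apply/eqP.
  rewrite (@eq_sform _ _ (fun i j => B i j * A i j ^+ d * A i j ^+ e)
    (fun i j => B i j * A i j ^+ (d + e))); first ring.
  by move=> i j; rewrite exprD mulrA.
Qed.

End Bound.

(** * Domination of Hadamard powers *)

Section DominationPart.
Local Open Scope sesquilinear_scope.
Local Open Scope ring_scope.

Lemma mx_formE (C : numClosedFieldType) n (A : 'M[C]_n) (v : 'cV[C]_n) :
  (v ^t* *m A *m v) 0 0 = sform A (fun i => v i 0) (fun i => v i 0).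
Proof.
rewrite !mxE /sform exchange_big; apply: eq_bigr => j _.
by rewrite !mxE mulr_suml; apply: eq_bigr => i _; rewrite !mxE.
Qed.

(** Spectral theorem: [A = P^* diag(d) P] is the Gram matrix of the columns of
    [diag(sqrt d) P]. *)
Lemma psd_gram_kernel (C : numClosedFieldType) n (A : 'M[C]_n) :
  A \is hermsymmx -> (forall v : 'cV[C]_n, 0 <= (v ^t* *m A *m v) 0 0) ->
  gram_kernel (fun i j => A i j).
Proof.
move=> hA posA; have /orthomx_spectralP := hermitian_normalmx hA.
set P := spectralmx A; set d := spectral_diag A => AE.
have uP : P \is unitarymx := spectral_unitarymx A.
have d_ge0 k : 0 <= d 0 k.
  have := posA (P^t* *m delta_mx k 0).
  rewrite trmx_mul map_mxM trmxCK AE invmx_unitary // !mulmxA.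
  rewrite mulmxtVK // mulmxtVK //.
  rewrite trmx_delta map_delta_mx -rowE -colE !mxE.
  by rewrite eqxx mulr1n.
exists 'I_n, (fun k i => sqrtC (d 0 k) * P k i) => i j.
rewrite {1}AE invmx_unitary // !mxE; apply: eq_bigr => k _.
rewrite mul_mx_diag !mxE rmorphM /=.
have -> : (sqrtC (d 0 k))^* = sqrtC (d 0 k).
  by rewrite conj_Creal // ger0_real // sqrtC_ge0.
by rewrite [RHS]mulrACA -expr2 sqrtCK; ring.
Qed.

Section Domination.
Variables (C : numClosedFieldType) (n : nat) (A : 'I_n -> 'I_n -> C) (rho : C).
Hypothesis gA : gram_kernel A.
Hypothesis A_le : forall t, A t t <= rho.
Hypothesis rho_ge0 : 0 <= rho.

(** With [q_j] the form of [A^(o j)] at [w] and [x_j] the inner product of [w] and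
    [H_j w] for that form, the interpolation identity reads
    [q_L = \sum_j sg_j x_j], where [L = a + n].  Positivity of the form at
    [t c_j w - sg_j H_j w] bounds [2 Re (sg_j x_j)] by [t c_j q_j] plus a multiple
    of [q_L]; by the choice of [t] these multiples add up to at most one. *)
Theorem hadamard_domination (a : nat) (c : 'I_n -> C) (t : C) (w : 'I_n -> C) :
  (forall j, 0 < c j) -> 0 < t ->
  \sum_(j < n) (hook_count a n j)%:R ^+ 2 * (rho ^+ (a + n - j) / c j) <= t ->
  sform (fun i k => A i k ^+ (a + n)) w w <=
    t * \sum_(j < n) c j * sform (fun i k => A i k ^+ j) w w.
Proof.
move=> c0 t0 ht.
pose H (j : nat) i := (hook_poly a [seq A s i | s <- enum 'I_n])`_j.
pose sg (j : nat) : C := - (-1) ^+ n * (-1) ^+ j.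
have sg2 j : sg j * sg j = 1.
  by rewrite /sg mulrACA mulrNN -!expr2 !sqrr_sign mulr1.
have sgC j : (sg j)^* = sg j.
  by rewrite /sg rmorphM rmorphN !rmorphXn !rmorphN1.
(* the entry [A s i] is one of the nodes of column [i] *)
have interp s i : A s i ^+ (a + n) = \sum_(j < n) sg j * (H j i * A s i ^+ j).
  have := @exp_node_hook_poly _ (A s i) [seq A s i | s <- enum 'I_n] a.
  by rewrite size_map size_enum_ord; apply; apply: map_f; rewrite mem_enum.
set q := fun j => sform (fun i k => A i k ^+ j) w w.
pose Hw j i := H j i * w i.
pose x j := sform (fun i k => A i k ^+ j) w (Hw j).
have qE : q (a + n)%N = \sum_(j < n) sg j * x j.
  rewrite /q /sform; under eq_bigr do under eq_bigr do
    rewrite interp mulr_sumr mulr_suml.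
  under eq_bigr do rewrite exchange_big; rewrite exchange_big.
  apply: eq_bigr => j _; rewrite /x /sform mulr_sumr; apply: eq_bigr => i _.
  by rewrite mulr_sumr; apply: eq_bigr => k _; rewrite /Hw; ring.
have q_ge0 j : 0 <= q j by apply: gram_ge0; exact: gram_exp.
have Hq (j : 'I_n) : sform (fun i k => A i k ^+ j) (Hw j) (Hw j)
    <= (hook_count a n j)%:R ^+ 2 * (rho ^+ (a + n - j) * q (a + n)%N).
  have dj : (a + n - j + j = a + size (enum 'I_n))%N.
    by rewrite size_enum_ord subnK // (leq_trans (ltnW (ltn_ord j))) // leq_addl.
  have := hook_poly_bound (mul_bound_graded gA rho_ge0) (mul_bound_row gA A_le) dj.
  rewrite size_enum_ord => /(_ _ (gram_exp j gA) w).
  rewrite (@eq_sform _ _ (fun i k => A i k ^+ j * A i k ^+ _)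
    (fun i k => A i k ^+ (a + n))) // => i k.
  by rewrite -exprD subnKC // (leq_trans (ltnW (ltn_ord j))) // leq_addl.
have key (j : 'I_n) : sg j * x j + (sg j * x j)^* <=
   t * (c j * q j) + t^-1 * ((hook_count a n j)%:R ^+ 2 *
      (rho ^+ (a + n - j) / c j)) * q (a + n)%N.
  set e := t * c j; have e0 : 0 < e by rewrite mulr_gt0.
  have eC : e^* = e by rewrite conj_Creal // gtr0_real.
  have := gram_ge0 (fun i => e * w i - sg j * Hw j i) (gram_exp j gA).
  have -> : sform (fun i k => A i k ^+ j) (fun i => e * w i - sg j * Hw j i)
     (fun i => e * w i - sg j * Hw j i) = e * e * q j
      - e * (sg j * x j + (sg j * x j)^*)
      + sform (fun i k => A i k ^+ j) (Hw j) (Hw j).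
    have -> : (sg j * x j)^* =
        \sum_i \sum_k sg j * ((Hw j i)^* * A i k ^+ j * w k).
      rewrite rmorphM /= sgC /x /sform rmorph_sum mulr_sumr exchange_big.
      apply: eq_bigr => i _; rewrite rmorph_sum mulr_sumr; apply: eq_bigr => k _.
      by rewrite !rmorphM /= conjCK rmorphXn /= (gram_conj _ _ gA); ring.
    rewrite mulrDr /x /q /sform !mulr_sumr -big_split -sumrB -big_split.
    apply: eq_bigr => i _; rewrite !mulr_sumr -big_split -sumrB -big_split.
    apply: eq_bigr => k _ /=.
    rewrite rmorphB (rmorphM _ e) (rmorphM _ (sg j)) /= eC sgC.
    rewrite -[X in _ = _ + X]mul1r -(sg2 j); ring.
  move=> /le_trans /(_ (lerD (lexx _) (Hq j))) h.
  rewrite -subr_ge0 -(pmulr_rge0 _ e0); apply: le_trans h _.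
  rewrite le_eqVlt; apply/orP; left; apply/eqP; rewrite /e; field.
  by rewrite !gt_eqF.
rewrite -/(q _) -(ler_pM2l (ltr0Sn C 1)).
have qC : (q (a + n)%N)^* = q (a + n)%N by rewrite conj_Creal // ger0_real.
have : q (a + n)%N + (q (a + n)%N)^* <= t * (\sum_(j < n) c j * q j) + q (a + n)%N.
  rewrite {1 2}qE rmorph_sum -big_split /=.
  apply: le_trans (ler_sum _ (fun j _ => key j)) _.
  rewrite big_split /= -mulr_sumr lerD2l -mulr_suml -mulr_sumr.
  rewrite -[X in _ <= X]mul1r; apply: ler_wpM2r => //.
  by rewrite mulrC ler_pdivrMr // mul1r.
by rewrite qC lerD2r => /(ler_wpM2l (ler0n C 2)).
Qed.

End Domination.

End DominationPart.

(** * The matrix cube *)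

Section CubePart.
Local Open Scope complex_scope.
Local Open Scope ring_scope.

Lemma psdmx_of_sform (R : realType) N (A : 'M[R[i]]_N) :
  (forall i j, (A i j)^* = A j i) -> (forall w, 0 <= sform A w w) -> psdmx A.
Proof.
move=> hA pA; split; last by move=> v; rewrite mx_formE.
by apply/is_hermitianmxP; rewrite expr0 scale1r; apply/matrixP => i j; rewrite !mxE hA.
Qed.

Lemma sform_sum (C : numClosedFieldType) (I : finType) (J : Type) (r : seq J)
    (P : pred J) (a : J -> C) (B : J -> I -> I -> C) u w :
  sform (fun i j => \sum_(k <- r | P k) a k * B k i j) u w
    = \sum_(k <- r | P k) a k * sform (B k) u w.
Proof.
rewrite /sform; under eq_bigr do under eq_bigr do rewrite mulr_sumr mulr_suml.
under eq_bigr do rewrite exchange_big; rewrite exchange_big.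
apply: eq_bigr => k _; rewrite mulr_sumr; apply: eq_bigr => i _.
by rewrite mulr_sumr; apply: eq_bigr => j _; ring.
Qed.

Lemma sformD (C : numClosedFieldType) (I : finType) (A B : I -> I -> C) u w :
  sform (fun i j => A i j + B i j) u w = sform A u w + sform B u w.
Proof.
rewrite /sform -big_split; apply: eq_bigr => i _; rewrite -big_split.
by apply: eq_bigr => j _ /=; ring.
Qed.

Section Cube.
Variables (R : realType) (N : nat) (c : 'I_N -> R).

Lemma cube_form (A : 'M[R[i]]_N) n (u : nat -> R) w :
  sform (cube_term c A 0 + \sum_(1 <= m < n.+1) (u m)%:C *: cube_term c A m) w w
  = \sum_(j < N) (c j)%:C * sform (fun i k => A i k ^+ j) w w
    + \sum_(0 <= m < n) (u m.+1)%:C * sform (fun i k => A i k ^+ (m + N)) w w.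
Proof.
case: N c A w => [|N'] c' A w.
  rewrite /sform !big_ord0 add0r big1_seq // => m _.
  by rewrite big_ord0 mulr0.
rewrite -!sform_sum -sformD; apply: eq_sform => i k.
rewrite mxE !summxE big_add1 /=; congr (_ + _).
  by apply: eq_bigr => j _; rewrite !mxE.
apply: eq_bigr => m _; rewrite !mxE; congr (_ * _ ^+ _).
by rewrite subn1 /= addnS addnC addnS.
Qed.

Lemma Ccst_gt0 rho L : (1 <= N)%N -> (forall j, 0 < c j) -> 0 < rho -> (N <= L)%N ->
  0 < Ccst c L rho.
Proof.
move=> N1 c0 r0 NL; rewrite /Ccst.
have t0 (j : 'I_N) : 0 < ('C(L, j) ^ 2 * 'C(L - j - 1, N - j - 1) ^ 2)%:R
               * (rho ^+ (L - j) / c j).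
  rewrite mulr_gt0 ?divr_gt0 ?exprn_gt0 //.
  rewrite ltr0n muln_gt0 !expn_gt0 !bin_gt0.
  have := ltn_ord j; move: (nat_of_ord j) => k kN.
  by apply/andP; split; apply/orP; left; lia.
rewrite (bigD1 (Ordinal N1)) //=; apply: ltr_pwDl (t0 (Ordinal N1)) _.
by apply: sumr_ge0 => j _; exact: ltW (t0 j).
Qed.

Lemma CcstE rho m : Ccst c (N + m) rho =
  \sum_(j < N) (hook_count m N j)%:R ^+ 2 * (rho ^+ (m + N - j) / c j).
Proof.
apply: eq_bigr => j _; rewrite /hook_count ltn_ord -natrX expnMn (addnC N m).
by [].
Qed.

(** The worst case is [u_m = - eta] for all [m]; there the domination of each
    [A^(o (N + m))] by [C_m S], with [S] the form of [A_0], leaves at least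
    [S * (1 - eta * \sum_m C_m)]. *)
Lemma cube_psd rho M eta (A : 'M[R[i]]_N) : (1 <= N)%N -> (forall j, 0 < c j) ->
  0 < rho -> 0 < eta ->
  eta <= (\sum_(0 <= m < M.+1) Ccst c (N + m) rho)^-1 ->
  psd_over (closed_disc rho) A ->
  matrix_cube M.+1 (cube_term c A) eta `<=` psd_over setT.
Proof.
move=> N1 c0 r0 e0 he [[hA pA] dA] X [u hu ->]; split => //.
have gA := psd_gram_kernel hA pA.
have q_ge0 k w : 0 <= sform (fun i j => A i j ^+ k) w w.
  exact: gram_ge0 (gram_exp k gA).
have A_le t : A t t <= rho%:C.
  rewrite -[A t t]ger0_norm; first exact: dA.
  case: gA => K [Q AQ]; rewrite AQ sumr_ge0 // => k _.
  by rewrite -normCKC exprn_ge0.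
have conjAX k i j : (A i j ^+ k)^* = A j i ^+ k.
  by rewrite rmorphXn /= (gram_conj _ _ gA).
have conjR (x : R) : (x%:C)^* = x%:C by rewrite conj_Creal // complex_real.
apply: psdmx_of_sform => [i j|w].
  rewrite !mxE !summxE rmorphD !rmorph_sum /=; congr (_ + _).
    by apply: eq_bigr => l _; rewrite !mxE rmorphM /= conjAX conjR.
  rewrite !big_add1 /=; apply: eq_bigr => m _.
  by rewrite !mxE rmorphM /= conjAX conjR.
rewrite cube_form.
set S := \sum_(j < N) _.
have S0 : 0 <= S.
  by rewrite sumr_ge0 // => j _; rewrite mulr_ge0 ?ler0c ?(ltW (c0 j)).
have dom m : sform (fun i k => A i k ^+ (m + N)) w w
    <= (Ccst c (N + m) rho)%:C * S.
  apply: (hadamard_domination gA A_le) => //.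
  - by rewrite ler0c ltW.
  - by move=> j; rewrite ltcR.
  - by rewrite ltcR Ccst_gt0 ?leq_addr.
  rewrite CcstE rmorph_sum /= le_eqVlt; apply/orP; left; apply/eqP.
  apply: eq_bigr => j _.
  by rewrite rmorphM rmorphXn rmorph_nat rmorphM /= fmorphV rmorphXn.
apply: (@le_trans _ _ (S - \sum_(0 <= m < M.+1)
    eta%:C * ((Ccst c (N + m) rho)%:C * S))).
  rewrite -mulr_sumr -mulr_suml mulrA -[X in X - _]mul1r -mulrBl.
  rewrite mulr_ge0 // subr_ge0 -rmorph_sum -rmorphM /= -(rmorph1 (real_complex R)).
  rewrite lecR -ler_pdivlMr ?mul1r //.
  by rewrite big_nat_recl // ltr_pwDl ?Ccst_gt0 ?leq_addr // sumr_ge0 // => m _;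
    rewrite ltW // Ccst_gt0 ?leq_addr.
rewrite lerD2l -sumrN; apply: ler_sum_nat => m /andP[_ mM].
have /andP[hu1 hu2] := hu m.+1 mM.
apply: (@le_trans _ _ (- (eta%:C * sform (fun i k => A i k ^+ (m + N)) w w))).
  by rewrite lerN2 ler_wpM2l // ler0c ltW.
by rewrite -mulNr ler_wpM2r // -rmorphN lecR.
Qed.

End Cube.

End CubePart.

(** * Sharpness on matrices of rank one *)

Section SharpnessPart.
Local Open Scope complex_scope.
Local Open Scope ring_scope.

Section Lower.
Variables (R : realDomainType) (m : R).
Hypothesis m0 : 0 <= m.

Definition lower_bound (d k : nat) (f : unit -> R) : Prop := k%:R * m ^+ d <= f tt.

Lemma lower_bound_graded : graded_bound lower_bound.
Proof.
rewrite /lower_bound; split.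
- by move=> d k f g hf <-.
- by move=> d; rewrite mul0r.
- by rewrite mulr1.
- by move=> d k l f g hf hg; rewrite natrD mulrDl lerD.
- move=> d e k l f g hf hg; rewrite natrM exprD mulrACA ler_pM //;
  by rewrite mulr_ge0 ?exprn_ge0.
Qed.

(** All monomials have coefficient one, so each contributes at least
    [m ^+ (a + size s - j)]. *)
Lemma hook_poly_ge (s : seq R) a j : all (fun x => m <= x) s -> (j <= a + size s)%N ->
  (hook_count a (size s) j)%:R * m ^+ (a + size s - j) <= (hook_poly a s)`_j.
Proof.
move=> /allP ms js.
(* truncation below by [m] gives generators bounded below on all of [R], and
   does not change the nodes *)
have hy (t : R) : lower_bound 1 1 (fun _ => Num.max m t).
  by rewrite /lower_bound mul1r expr1 le_max lexx.
have := @hook_poly_bound _ _ _ _ lower_bound_graded _ hy a s j (a + size s - j).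
rewrite subnK // /lower_bound (_ : [seq Num.max m t | t <- s] = s); first exact.
by rewrite -[RHS]map_id; apply/eq_in_map => x xs; apply/max_idPr/ms.
Qed.

End Lower.

(** Passage to the limit [s -> 1], by Bernoulli's inequality. *)
Lemma le1_of_exp (R : realFieldType) (b : R) k :
  (forall s, 0 < s -> s < 1 -> b * s ^+ k <= 1) -> b <= 1.
Proof.
move=> h; rewrite leNgt; apply/negP => b1.
have b0 : 0 < b by exact: lt_trans b1.
have bern (e : R) : 0 < e -> e < 1 -> 1 - k%:R * e <= (1 - e) ^+ k.
  move=> e0 e1; elim: (k) => [|l IH]; first by rewrite mul0r subr0 expr0.
  rewrite exprS -natr1.
  have e2 : 0 <= 1 - e by rewrite subr_ge0 ltW.
  apply: le_trans (ler_wpM2l e2 IH).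
  have : 0 <= l%:R * e * e by rewrite !mulr_ge0 // ltW.
  nra.
pose e := (1 - b^-1) / k.+1%:R.
have d0 : 0 < 1 - b^-1 by rewrite subr_gt0 invf_lt1.
have e0 : 0 < e by rewrite divr_gt0.
have ke : k%:R * e + e = 1 - b^-1.
  rewrite -{2}[e]mul1r -mulrDl natr1 /e mulrCA mulfV ?mulr1 //.
have k0 : 0 <= k%:R * e by rewrite mulr_ge0 // ltW.
have bV : 0 < b^-1 by rewrite invr_gt0.
have e1 : e < 1.
  have e1 : e <= k%:R * e + e by rewrite lerDr.
  by apply: le_lt_trans e1 _; rewrite ke gtrBl.
have := h (1 - e); rewrite subr_gt0 e1 => /(_ isT).
rewrite ltrBlDr ltrDl e0 => /(_ isT).
apply/negP; rewrite -ltNge.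
apply: lt_le_trans (ler_wpM2l (ltW b0) (bern e e0 e1)).
by rewrite -ltr_pdivrMl // mulr1 ltrBrDl -ltrBrDr -ke ltrDl.
Qed.

Section Necessity.
Variables (R : realType) (N : nat) (c : 'I_N -> R).
Hypothesis c0 : forall j, 0 < c j.

(** Invertibility of the Vandermonde matrix. *)
Lemma moment_solve (x b : 'I_N -> R) : injective x ->
  exists v : 'I_N -> R, forall j : 'I_N, \sum_i v i * x i ^+ j = b j.
Proof.
move=> xI; pose V := Vandermonde N (\row_i x i).
have uV : V \in unitmx.
  rewrite unitmxE det_Vandermonde unitfE; apply/prodf_neq0 => i _.
  apply/prodf_neq0 => j ij; rewrite !mxE subr_eq0; apply/eqP => /xI ji.
  by rewrite ji ltnn in ij.
exists (fun i => (invmx V *m \col_j b j) i 0) => j.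
have /matrixP /(_ j 0) := mulKVmx uV (\col_j b j).
rewrite [in RHS]mxE => <-; rewrite [in RHS]mxE.
by apply: eq_bigr => i _; rewrite !mxE mulrC.
Qed.

Lemma sform_rank1 (x v : 'I_N -> R) k :
  sform (fun i j => ((x i * x j)%:C) ^+ k) (fun i => (v i)%:C) (fun i => (v i)%:C)
  = ((\sum_i v i * x i ^+ k) ^+ 2)%:C.
Proof.
rewrite expr2 mulr_suml rmorph_sum; apply: eq_bigr => i _.
rewrite mulr_sumr rmorph_sum; apply: eq_bigr => j _ /=.
have -> : ((v i)%:C)^* = (v i)%:C by rewrite conj_Creal // complex_real.
by rewrite -rmorphXn -!rmorphM /=; congr (_%:C); rewrite exprMn; ring.
Qed.

Lemma rank1_psd_over (rho : R) (x : 'I_N -> R) :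
  (forall i, 0 <= x i) -> (forall i, x i ^+ 2 <= rho) ->
  psd_over (closed_disc rho) (\matrix_(i, j) (x i * x j)%:C).
Proof.
move=> x0 xr; split => [|i j].
  have conjR (y : R) : (y%:C)^* = y%:C by rewrite conj_Creal // complex_real.
  apply: psdmx_of_sform => [i j|w]; first by rewrite !mxE conjR mulrC.
  apply: gram_ge0; exists unit, (fun _ i => (x i)%:C) => i j.
  by rewrite mxE sumr_const card_unit mulr1n conjR -rmorphM.
rewrite /closed_disc /= mxE ger0_norm ?ler0c ?mulr_ge0 // lecR.
have := x0 i; have := x0 j; have := xr i; have := xr j; have := sqr_ge0 (x i - x j).
nra.
Qed.

Variables (rho eta : R) (M : nat).
Hypotheses (N1 : (1 <= N)%N) (rho0 : 0 < rho) (eta0 : 0 < eta).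
Hypothesis cube : forall A : 'M[R[i]]_N, psd_over (closed_disc rho) A ->
  matrix_cube M.+1 (cube_term c A) eta `<=` psd_over setT.

(** Apply the hypothesis to [A = x x^T] with [u = (0, ..., 0, - eta)] and to the
    vector [v] with moments [sg_j H_j / c_j], the case of equality in the
    Cauchy-Schwarz inequality: both [\sum_j c_j (\sum_i v_i x_i ^ j)^2] and
    [\sum_i v_i x_i ^ (M + N)] are then [T = \sum_j H_j ^ 2 / c_j], and positivity
    reads [eta T ^ 2 <= T]. *)
Lemma rank1_bound (m : R) (x : 'I_N -> R) : injective x ->
  0 < m -> (forall i, m <= x i) -> (forall i, x i ^+ 2 <= rho) ->
  eta * \sum_(j < N) ((hook_count M N j)%:R * m ^+ (M + N - j)) ^+ 2 / c j <= 1.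
Proof.
move=> xI m0 mx xr.
have x0 i : 0 <= x i by rewrite (le_trans (ltW m0)).
pose s := [seq x i | i <- enum 'I_N].
have ss : size s = N by rewrite size_map size_enum_ord.
pose H j := (hook_poly M s)`_j.
pose sg (j : nat) : R := - (-1) ^+ N * (-1) ^+ j.
have sg2 j : sg j * sg j = 1.
  by rewrite /sg mulrACA mulrNN -!expr2 !sqrr_sign mulr1.
have xE i : x i ^+ (M + N) = \sum_(j < N) sg j * (H j * x i ^+ j).
  have := @exp_node_hook_poly _ (x i) s M.
  by rewrite ss; apply; apply: map_f; rewrite mem_enum.
have [v vE] := moment_solve (fun j => sg j * H j / c j) xI.
set T := \sum_(j < N) H j ^+ 2 / c j.
have vL : \sum_i v i * x i ^+ (M + N) = T.
  under eq_bigr do rewrite xE mulr_sumr.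
  rewrite exchange_big; apply: eq_bigr => j _ /=.
  transitivity (sg j * H j * \sum_i v i * x i ^+ j).
    by rewrite mulr_sumr; apply: eq_bigr => i _; ring.
  rewrite vE; transitivity ((sg j * sg j) * (H j ^+ 2 / c j)); first ring.
  by rewrite sg2 mul1r.
have TE : \sum_(j < N) c j * (\sum_i v i * x i ^+ j) ^+ 2 = T.
  apply: eq_bigr => j _; rewrite vE.
  transitivity ((sg j * sg j) * (H j ^+ 2 / c j)); last by rewrite sg2 mul1r.
  by field; rewrite gt_eqF.
have eT : eta * T <= 1.
  pose A := (\matrix_(i, j) (x i * x j)%:C : 'M[R[i]]_N).
  pose u k := if k == M.+1 then - eta else 0.
  have Xmem : matrix_cube M.+1 (cube_term c A) eta
      (cube_term c A 0 + \sum_(1 <= k < M.+2) (u k)%:C *: cube_term c A k).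
    exists u => // k _; rewrite /u; case: eqP => _.
      by rewrite lexx /= lerNl (le_trans _ (ltW eta0)) // oppr_le0 ltW.
    by rewrite oppr_le0 (ltW eta0).
  have [[_ Xpos] _] := cube (rank1_psd_over x0 xr) Xmem.
  have := Xpos (\col_i (v i)%:C); rewrite mx_formE cube_form.
  have formE k : sform (fun i l => A i l ^+ k) (fun i => (\col_i (v i)%:C) i 0)
     (fun i => (\col_i (v i)%:C) i 0) = ((\sum_i v i * x i ^+ k) ^+ 2)%:C.
    rewrite -sform_rank1 /sform; do 2!apply: eq_bigr => ? _.
    by rewrite !mxE.
  under eq_bigr do rewrite formE -rmorphM.
  rewrite -rmorph_sum /= TE big_nat_recr //= big_nat big1 => [|k /= kM]; last first.
    by rewrite /u eqSS (ltn_eqF kM) rmorph0 mul0r.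
  rewrite add0r /u eqxx formE -rmorphM -rmorphD ler0c /= vL => hT.
  have [T0|T0] := ltP 0 T; last first.
    by apply: le_trans ler01; rewrite pmulr_rle0.
  rewrite -(ler_pM2r T0); move: hT; rewrite mul1r mulNr subr_ge0.
  by rewrite expr2 mulrA.
apply: le_trans eT; rewrite ler_pM2l //; apply: ler_sum => j _.
have lo_ge0 : 0 <= (hook_count M N j)%:R * m ^+ (M + N - j).
  by rewrite mulr_ge0 ?exprn_ge0 ?ler0n ?(ltW m0).
have Hge : (hook_count M N j)%:R * m ^+ (M + N - j) <= H j.
  have := @hook_poly_ge _ m (ltW m0) s M j; rewrite ss; apply.
    by apply/allP => y /mapP[i _ ->].
  by rewrite (leq_trans (ltnW (ltn_ord j))) // leq_addl.
by rewrite ler_pM2r ?invr_gt0 // lerXn2r ?nnegrE // (le_trans lo_ge0).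
Qed.

(** Distinct nodes in the interval from [s * sqrt rho] to [sqrt rho], and
    [s -> 1]. *)
Lemma cube_bound : eta <= (Ccst c (N + M) rho)^-1.
Proof.
have C0 : 0 < Ccst c (N + M) rho by rewrite Ccst_gt0 ?leq_addr.
rewrite -[X in _ <= X]mul1r ler_pdivlMr //.
apply: (@le1_of_exp _ _ (2 * (M + N))) => s s0 s1.
pose r := Num.sqrt rho.
have r0 : 0 < r by rewrite sqrtr_gt0.
have r2 : r ^+ 2 = rho by rewrite sqr_sqrtr // ltW.
pose m := r * s.
have m0 : 0 < m by rewrite mulr_gt0.
have mr : m < r by rewrite gtr_pMr.
have NR : 0 < N%:R :> R by rewrite ltr0n.
pose x (i : 'I_N) := m + (r - m) / N%:R * i%:R.
have g0 : 0 < (r - m) / N%:R by rewrite divr_gt0 // subr_gt0.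
have xI : injective x.
  move=> i j /addrI /(mulfI (lt0r_neq0 g0)) /eqP; rewrite eqr_nat => /eqP.
  exact: val_inj.
have mx i : m <= x i by rewrite lerDl mulr_ge0 // ltW.
have xr i : x i ^+ 2 <= rho.
  rewrite -r2 lerXn2r ?nnegrE ?(ltW r0) ?(le_trans (ltW m0)) //.
  rewrite /x -lerBrDl -mulrA -ler_pdivlMl ?subr_gt0 // mulVf ?gt_eqF ?subr_gt0 //.
  by rewrite mulrC ler_pdivrMr // mul1r ler_nat ltnW.
apply: le_trans (rank1_bound xI m0 mx xr).
rewrite -mulrA ler_pM2l // CcstE mulr_suml; apply: ler_sum => j _.
have mE k : (m ^+ k) ^+ 2 = rho ^+ k * s ^+ (2 * k).
  by rewrite /m exprMn exprMn -!exprM (mulnC k 2) exprM r2.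
rewrite exprMn mE [X in _ <= X](_ : _ = (hook_count M N j)%:R ^+ 2 *
  (rho ^+ (M + N - j) / c j) * s ^+ (2 * (M + N - j))); last by ring.
apply: ler_wpM2l.
  by rewrite mulr_ge0 ?sqr_ge0 // divr_ge0 ?exprn_ge0 ?(ltW rho0) ?(ltW (c0 j)).
by rewrite ler_wiXn2l ?(ltW s0) ?(ltW s1) // leq_mul2l leq_subr.
Qed.

End Necessity.

End SharpnessPart.

(** * Asymptotics *)

(** With [L = m + N], the quotient of the two numbers of monomials is
    [(L + 1) (L - j) / ((m + 1) (L + 1 - j))], and [L + 1 - j <= 2 (L - j)]. *)
Lemma hook_count_growth m N j : (j < N)%N ->
  (N * hook_count m N j <= 2 * m.+1 * hook_count m.+1 N j)%N.
Proof.
move=> jN; rewrite /hook_count jN.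
set L := (m + N)%N.
have LE : (m.+1 + N = L.+1)%N by rewrite addSn.
rewrite LE.
have b1 : (L.+1 * 'C(L, j) = (L.+1 - j) * 'C(L.+1, j))%N.
  exact: (mul_bin_down L.+1 j).
have -> : (L.+1 - j - 1 = (L - j - 1).+1)%N by rewrite /L; lia.
have b2 : ((L - j) * 'C(L - j - 1, N - j - 1)
   = m.+1 * 'C((L - j - 1).+1, N - j - 1))%N.
  have := mul_bin_down (L - j - 1).+1 (N - j - 1); rewrite [_.-1]/=.
  have -> : ((L - j - 1).+1 = L - j)%N by rewrite /L; lia.
  have -> : (L - j - (N - j - 1) = m.+1)%N by rewrite /L; lia.
  by move=> ->.
set B := 'C(L, j) in b1 *; set B' := 'C(L.+1, j) in b1 *.
set D := 'C(L - j - 1, _) in b2 *; set D' := 'C(_.+1, _) in b2 *.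
have e1 : (0 < L - j)%N by rewrite /L; lia.
rewrite -(leq_pmul2r e1).
have -> : (N * (B * D) * (L - j) = N * B * (m.+1 * D'))%N by rewrite -b2; ring.
have h1 : (N * B <= (L.+1 - j) * B')%N.
  by rewrite -b1 leq_mul2r /L; apply/orP; right; lia.
have h2 : (L.+1 - j <= 2 * (L - j))%N by rewrite /L; lia.
apply: leq_trans (leq_mul h1 (leqnn _)) _.
apply: leq_trans (leq_mul (leq_mul h2 (leqnn _)) (leqnn _)) _.
by apply/eq_leq; ring.
Qed.

Section Limit.
Variables (R : realType) (rho : R).
Hypothesis rho0 : 0 < rho.

Lemma Ccst_growth N (c : 'I_N -> R) m : (forall j, 0 < c j) ->
  N%:R ^+ 2 * rho * Ccst c (N + m) rho
    <= (2 * m.+1)%:R ^+ 2 * Ccst c (N + m.+1) rho.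
Proof.
move=> c0; rewrite !CcstE !mulr_sumr; apply: ler_sum => j _.
have jL : (j <= m + N)%N by rewrite (leq_trans (ltnW (ltn_ord j))) ?leq_addl.
rewrite addSn subSn // (exprS rho (m + N - j)).
have -> : N%:R ^+ 2 * rho * ((hook_count m N j)%:R ^+ 2 * (rho ^+ (m + N - j) / c j))
  = (N * hook_count m N j)%:R ^+ 2 * (rho * rho ^+ (m + N - j) / c j).
  by rewrite natrM; ring.
rewrite [X in _ <= X]mulrA -exprMn -natrM.
apply: ler_wpM2r.
  by rewrite divr_ge0 ?(ltW (c0 j)) // mulr_ge0 ?exprn_ge0 ?ltW.
by rewrite lerXn2r ?nnegrE // ler_nat hook_count_growth.
Qed.

Variable M : nat.

(** A bound for the quotient of consecutive constants, uniform in [c]. *)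
Let q (N : nat) : R := (2 * M)%:R ^+ 2 / rho / N%:R ^+ 2.

Lemma Ccst_ratio N (c : 'I_N -> R) m : (1 <= N)%N -> (forall j, 0 < c j) ->
  (m < M)%N -> Ccst c (N + m) rho <= q N * Ccst c (N + m.+1) rho.
Proof.
move=> N1 c0 mM.
have NR : 0 < N%:R :> R by rewrite ltr0n.
have d0 : 0 < N%:R ^+ 2 * rho by rewrite mulr_gt0 ?exprn_gt0.
rewrite -(ler_pM2l d0); apply: le_trans (Ccst_growth m c0) _.
have -> : N%:R ^+ 2 * rho * (q N * Ccst c (N + m.+1) rho)
    = (2 * M)%:R ^+ 2 * Ccst c (N + m.+1) rho.
  by rewrite /q; field; rewrite !gt_eqF.
apply: ler_wpM2r; first by rewrite ltW // Ccst_gt0 ?leq_addr.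
by rewrite lerXn2r ?nnegrE // ler_nat leq_mul2l.
Qed.

Lemma q_ge0 N : 0 <= q N.
Proof. by rewrite /q !divr_ge0 ?exprn_ge0 ?(ltW rho0). Qed.

Lemma Ccst_le_last N (c : 'I_N -> R) m : (1 <= N)%N -> (forall j, 0 < c j) ->
  q N <= 1 -> (m < M)%N -> Ccst c (N + m) rho <= q N * Ccst c (N + M) rho.
Proof.
move=> N1 c0 q1 mM.
have mono k l : (k <= l)%N -> (l <= M)%N -> Ccst c (N + k) rho <= Ccst c (N + l) rho.
  elim: l => [|l IH]; first by rewrite leqn0 => /eqP ->.
  rewrite leq_eqVlt ltnS => /orP[/eqP -> //|kl] lM.
  apply: le_trans (IH kl (ltnW lM)) _.
  apply: le_trans (Ccst_ratio N1 c0 lM) _.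
  by rewrite ler_piMl // ltW // Ccst_gt0 ?leq_addr.
apply: le_trans (Ccst_ratio N1 c0 mM) _.
by rewrite ler_wpM2l ?q_ge0 // mono.
Qed.

Lemma q_cvg0 : q @ \oo --> (0 : R).
Proof.
have h : (fun n : nat => n%:R^-1 : R) @ \oo --> (0 : R).
  apply/gtr0_cvgV0; last exact: cvgr_idn.
  by near=> n; rewrite ltr0n; near: n; exact: nbhs_infty_gt.
rewrite -(mulr0 ((2 * M)%:R ^+ 2 / rho)).
rewrite /q.
apply: cvgM; first exact: cvg_cst.
rewrite [X in X @ _ --> _](_ : _ = (fun n : nat => n%:R^-1 * n%:R^-1)).
  by rewrite -(mulr0 (0:R)); exact: cvgM.
by apply/funext => n; rewrite expr2 invfM.
Unshelve. all: by end_near.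
Qed.

Lemma Ccst_sum_equiv (c : forall N : nat, 'I_N -> R) :
  (forall (N : nat) (j : 'I_N), 0 < c N j) ->
  (fun N : nat => (Ccst (c N) (N + M) rho)^-1 *
     \sum_(0 <= m < M.+1) Ccst (c N) (N + m) rho) @ \oo --> (1 : R).
Proof.
move=> c0.
apply: (@squeeze_cvgr _ _ _ _ (fun=> 1) (fun N => M%:R * q N + 1)); last 2 first.
- exact: cvg_cst.
- rewrite -[X in _ --> X]add0r -(mulr0 M%:R).
  by apply: cvgD; [apply: cvgM q_cvg0; exact: cvg_cst|exact: cvg_cst].
have q1 : \forall N \near \oo, q N <= 1.
  by apply: (cvgr_le _ q_cvg0); exact: ltr01.
near=> N.
have N1 : (1 <= N)%N by near: N; exact: nbhs_infty_gt.
have C0 m : 0 < Ccst (c N) (N + m) rho by rewrite Ccst_gt0 ?leq_addr.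
rewrite big_nat_recr //= mulrDr mulVf ?gt_eqF // lerDr lerD2r.
rewrite mulr_ge0 ?invr_ge0 ?(ltW (C0 _)) ?sumr_ge0 //=; last first.
  by move=> m _; exact: ltW.
rewrite mulrC ler_pdivrMr //.
apply: (@le_trans _ _ (\sum_(0 <= m < M) q N * Ccst (c N) (N + M) rho)).
  apply: ler_sum_nat => m /andP[_ mM]; apply: Ccst_le_last => //.
  by near: N.
by rewrite sumr_const_nat subn0 -[X in X <= _]mulr_natl mulrA.
Unshelve. all: by end_near.
Qed.

End Limit.

Theorem corollary1p5 (R : realType) (rho : R) (M : nat) (rho_gt0 : 0 < rho) :
  (forall (N : nat) (c : 'I_N -> R) (eta : R),
     (1 <= N)%N -> (forall j, 0 < c j) -> 0 < eta ->
     (eta <= (\sum_(0 <= m < M.+1) Ccst c (N + m) rho)^-1 ->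
        forall A : 'M[R[i]]_N, psd_over (closed_disc rho) A ->
          matrix_cube M.+1 (cube_term c A) eta `<=` psd_over setT)
     /\
     ((forall A : 'M[R[i]]_N, psd_over (closed_disc rho) A ->
          matrix_cube M.+1 (cube_term c A) eta `<=` psd_over setT) ->
        eta <= (Ccst c (N + M) rho)^-1))
  /\
  (forall c : forall N : nat, 'I_N -> R,
     (forall (N : nat) (j : 'I_N), 0 < c N j) ->
     (fun N : nat => (Ccst (c N) (N + M) rho)^-1 *
        \sum_(0 <= m < M.+1) Ccst (c N) (N + m) rho) @ \oo --> (1 : R)).
Proof.
split; last by move=> c c0; exact: Ccst_sum_equiv.
move=> N c eta N1 c0 eta0; split; last exact: cube_bound.
by move=> he A hA; exact: cube_psd hA.
Qed.
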